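(* Let $m$ be a positive integer, suppose that the index set $T$ is a bounded subset of $\mathbb{R}^m$, and let $\|\cdot\|$ be a norm on $\mathbb{R}^m$. If there is some Borel measurable map $F\colon\mathbb{R}\to\mathbb{R}$ with $\mathrm{E}^P(|F|)<+\infty$ such that $$|f_s(x)-f_t(x)|\leqslant\|s-t\|\,F(x)\quad\text{for all }s,t\in T\text{ and }x\in\mathbb{R},$$ then $\hat{\underline{\mathrm{E}}}_n(f)$ is a strongly consistent estimator of $\underline{\mathrm{E}}^{\mathscr{P}}(f)$.
   Context: Setting. $\mathscr{B}$ is the Borel $\sigma$-field on $\mathbb{R}$. $T$ is a non-empty index set, $\mathscr{P}=\{P_t : t\in T\}$ is a set of probability measures on $(\mathbb{R},\mathscr{B})$, and $P$ is a probability measure on $(\mathbb{R},\mathscr{B})$, not necessarily in $\mathscr{P}$. For a probability measure $Q$, $\mathrm{E}^Q(h)=\int h\,\mathrm{d}Q$. The map $f\colon\mathbb{R}\to\mathbb{R}$ is Borel measurable with $\sup_{t\in T}\mathrm{E}^{P_t}(|f|)<+\infty$, and $\underline{\mathrm{E}}^{\mathscr{P}}(f):=\inf_{t\in T}\mathrm{E}^{P_t}(f)$. For each $t\in T$, $f_t\colon\mathbb{R}\to\mathbb{R}$ is a Borel measurable map with $\mathrm{E}^P(f_t)=\mathrm{E}^{P_t}(f)$ and $\mathrm{E}^P(|f_t|)=\mathrm{E}^{P_t}(|f|)$ (so each $f_t$ is $P$-integrable). Sampling. $(\mathbb{R}^\infty,\mathscr{B}^\infty,P^\infty)$ is the countably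 infinite product of copies of $(\mathbb{R},\mathscr{B},P)$ and $X_k\colon\mathbb{R}^\infty\to\mathbb{R}$ is the $k$-th coordinate projection. The estimator is the (not necessarily measurable) extended real-valued map $\hat{\underline{\mathrm{E}}}_n(f):=\inf_{t\in T}\frac1n\sum_{k=1}^n f_t(X_k)$ on $\mathbb{R}^\infty$. Strong consistency. For any map $h\colon\mathbb{R}^\infty\to\overline{\mathbb{R}}:=\mathbb{R}\cup\{-\infty,+\infty\}$, $h^*$ denotes a minimal measurable cover: a measurable map $h^*\colon\mathbb{R}^\infty\to\overline{\mathbb{R}}$ with $h^*\geqslant h$ and such that every measurable $g\colon\mathbb{R}^\infty\to\overline{\mathbb{R}}$ with $g\geqslant h$ satisfies $g\geqslant h^*$ $P^\infty$-almost surely; it always exists and is unique up to $P^\infty$-null sets. The estimator is strongly consistent if $\big|\hat{\underline{\mathrm{E}}}_n(f)-\underline{\mathrm{E}}^{\mathscr{P}}(f)\big|^*\to0$ $P^\infty$-almost surely as $n\to+\infty$, where $|h|^*$ is the minimal measurable cover of $|h|$. *)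

(* Defs.v *)
From mathcomp Require Import all_boot all_order all_algebra.
From mathcomp Require Import all_classical all_reals all_analysis.
From mathcomp Require Import measurable_realfun.

Set Implicit Arguments.
Unset Strict Implicit.
Unset Printing Implicit Defensive.

Import Order.TTheory GRing.Theory Num.Theory.
Import numFieldNormedType.Exports.

Local Open Scope classical_set_scope.
Local Open Scope ring_scope.

(* An arbitrary norm on a real vector space, unrelated to the canonical norm
   that the library puts on it; nonnegativity follows from these axioms. *)
Definition is_norm (R : realType) (V : lmodType R) (N : V -> R) : Prop :=
  [/\ forall x y, N (x + y) <= N x + N y,
      forall (a : R) x, N (a *: x) = `|a| * N x &
      forall x, N x = 0 -> x = 0].

Section sequence_space.
Variable R : realType.

Definition coord_measurable : set (set (nat -> R)) :=
  \bigcup_k preimage_set_system setT (fun w : nat -> R => w k) measurable.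

(* The real sequences with the smallest sigma-algebra that makes all the
   coordinate projections Borel measurable; coordinates start at 0. *)
Definition seqR := g_sigma_algebraType coord_measurable.

(* Since the finite-dimensional measurable boxes are a pi-system generating the
   sigma-algebra, at most one probability measure Q satisfies this. *)
Definition is_product_measure (P : probability R R)
    (Q : probability seqR R) : Prop :=
  forall (n : nat) (A : nat -> set R), (forall k, measurable (A k)) ->
    Q [set w : nat -> R | forall k, (k < n)%N -> A k (w k)]
      = (\prod_(k < n) P (A k))%E.

End sequence_space.

Section minimal_measurable_cover.
Context d (T : measurableType d) (R : realType).
Implicit Type mu : probability T R.
Local Open Scope ereal_scope.

Definition is_min_cover mu (h hs : T -> \bar R) : Prop :=
  [/\ measurable_fun setT hs,
      forall x, h x <= hs x &
      forall g : T -> \bar R, measurable_fun setT g -> (forall x, h x <= g x) ->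
        {ae mu, forall x, hs x <= g x}].

Lemma measurable_hull mu (A : set T) : exists B, [/\ measurable B, A `<=` B &
  forall C, measurable C -> A `<=` C -> mu (B `\` C) = 0].
Proof.
pose S := [set mu C | C in [set C | measurable C /\ A `<=` C]].
have S_ge0 : 0 <= ereal_inf S by apply/ereal_infP => _ [C _ <-].
have S_le1 : ereal_inf S <= 1.
  apply: ereal_inf_lbound; exists setT; last exact: probability_setT.
  by split.
have S_fin : ereal_inf S \is a fin_num.
  by rewrite ge0_fin_numE// (le_lt_trans S_le1)// ltry.
have /choice[C CP] (n : nat) : exists C, [/\ measurable C, A `<=` C &
    mu C < ereal_inf S + n.+1%:R^-1%:E].
  have n0 : (0 < n.+1%:R^-1 :> R)%R by rewrite invr_gt0.
  have [_ [C [mC AC] <-] CS] := lb_ereal_inf_adherent n0 S_fin.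
  by exists C.
pose B := \bigcap_n C n.
have mB : measurable B by apply: bigcapT_measurable => n; have [] := CP n.
have AB : A `<=` B by move=> x Ax n _; have [_ + _] := CP n; exact.
have muB : mu B <= ereal_inf S.
  apply/lee_addgt0Pr => e e0.
  have [n ne] : exists n : nat, (n.+1%:R^-1 < e)%R.
    near \oo => n; exists n; near: n; exact: near_infty_natSinv_lt (PosNum e0).
  have [mC _ CS] := CP n.
  apply: (@le_trans _ _ (mu (C n))).
    by apply: le_measure; rewrite ?inE//; exact: bigcap_inf.
  by rewrite (le_trans (ltW CS))// leeD2l// lee_fin ltW.
exists B; split => // D mD AD.
have muBD : mu B <= mu (B `&` D).
  apply: (le_trans muB); apply: ereal_inf_lbound; exists (B `&` D) => //.
  by split; [exact: measurableI|rewrite subsetI].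
apply/eqP; rewrite eq_le measure_ge0 andbT measureD//; last first.
  by rewrite (le_lt_trans (probability_le1 _ _))// ltry.
have BDfin : mu (B `&` D) \is a fin_num.
  by rewrite fin_num_measure//; exact: measurableI.
by rewrite leeBlDl// ?adde0.
Unshelve. all: by end_near. Qed.

Lemma min_cover_exists mu (h : T -> \bar R) : exists hs, is_min_cover mu h hs.
Proof.
have /choice[A AP] (q : rat) := measurable_hull mu [set x | (ratr q)%:E < h x].
pose F (n : nat) (x : T) : \bar R :=
  if unpickle n is Some q then if x \in A q then (ratr q)%:E else -oo else -oo.
have mF n : measurable_fun setT (F n).
  rewrite /F; case: (unpickle n) => [q|]; last exact: measurable_cst.
  apply: measurable_fun_ifT; [|exact: measurable_cst..].
  apply: (measurable_fun_bool true); rewrite setTI (_ : _ @^-1` _ = A q).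
    by have [] := AP q.
  by apply/seteqP; split=> x; [exact: set_mem|exact: mem_set].
have hsP (x : T) y : (esups (F ^~ x) 0%N <= y) <->
    (forall q : rat, A q x -> (ratr q)%:E <= y).
  split=> [le_y q Aqx|le_y].
    apply: le_trans le_y; apply: ereal_sup_ubound; exists (pickle q) => //.
    by rewrite /F pickleK mem_set.
  apply: ge_ereal_sup => _ [n _ <-]; rewrite /F.
  case: (unpickle n) => [q|]; last exact: leNye.
  by case: ifPn => [/set_mem/le_y//|_]; exact: leNye.
have lt_dense (a b : \bar R) : a < b -> exists q : rat, a < (ratr q)%:E < b.
  have ratP (x y : R) : (x < y)%R -> exists q : rat, (x < ratr q < y)%R.
    by move/rat_in_itvoo => [q]; rewrite in_itv /= => xqy; exists q.
  case: a b => [a| |] [b| |]//=.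
  - by rewrite lte_fin => /ratP[q]; exists q; rewrite !lte_fin.
  - move=> _; have /ratP[q /andP[aq _]] : (a < a + 1)%R by rewrite ltrDl.
    by exists q; rewrite lte_fin aq ltry.
  - move=> _; have /ratP[q /andP[_ qb]] : (b - 1 < b)%R.
      by rewrite ltrBlDr ltrDl.
    by exists q; rewrite lte_fin qb ltNyr.
  - by move=> _; exists 0%R; rewrite ltNyr ltry.
exists (fun x => esups (F ^~ x) 0%N); split.
- exact: measurable_fun_esups.
- move=> x; rewrite leNgt; apply/negP => /lt_dense[q /andP[hsq qh]].
  have [_ hA _] := AP q.
  have /hsP/(_ q (hA x qh)) := lexx (esups (F ^~ x) 0%N).
  by rewrite leNgt hsq.
- move=> g mg hg.
  pose C (q : rat) := [set x | (ratr q)%:E < g x].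
  have mC q : measurable (C q).
    by rewrite -[C q]setTI; exact: emeasurable_fun_o_infty.
  pose N n := if unpickle n is Some q then A q `\` C q else set0.
  have N0 n : mu.-negligible (N n).
    rewrite /N; case: (unpickle n) => [q|]; last exact: negligible_set0.
    have [mA _ AC] := AP q; apply/negligibleP; first exact: measurableD.
    by apply: AC => // x /= /lt_le_trans; apply.
  apply: negligibleS (negligible_bigcup N0) => x /= hsg.
  apply: contrapT => xN; apply: hsg; apply/hsP => q Aqx.
  have [//|gq] := leP (ratr q)%:E (g x); exfalso; apply: xN.
  have Nx : N (pickle q) x.
    rewrite /N pickleK; split; first exact: Aqx.
    by apply/negP; rewrite -leNgt ltW.
  exact: (ex_intro2 _ _ (pickle q) I Nx).
Qed.

(* One choice of the minimal measurable cover; all of them agree mu-almost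
   everywhere. *)
Definition min_cover mu (h : T -> \bar R) : T -> \bar R :=
  sval (cid (min_cover_exists mu h)).

End minimal_measurable_cover.

Section estimation.
Variables (R : realType) (I : Type) (T : set I).
Local Open Scope ereal_scope.

Definition lower_expectation (P_ : I -> probability R R) (f : R -> R) : \bar R :=
  ereal_inf [set 'E_(P_ t)[f] | t in T].

(* The k-th observation is w (k - 1); the value at n = 0 is a junk value. *)
Definition lower_estimator (f_ : I -> R -> R) (n : nat) (w : seqR R) : \bar R :=
  ereal_inf [set (n%:R^-1 * \sum_(k < n) f_ t (w k))%:E | t in T].

Definition strongly_consistent (Pinf : probability (seqR R) R)
    (est : nat -> seqR R -> \bar R) (theta : \bar R) : Prop :=
  {ae Pinf, forall w,
    (fun n => min_cover Pinf (fun w' => `|est n w' - theta|) w) @ \oo --> 0}.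

End estimation.

(* Main.v *)
(* By the Lipschitz condition, over a finite eps-net of T the deviation of the
   estimator is at most the sum of the deviations of the sample means of f_t at
   the net points plus eps times the sample mean and the expectation of |F|.
   This majorant is measurable, hence dominates the minimal cover almost surely,
   and the strong law of large numbers makes its limit 2 eps E|F|.

   The strong law is obtained from Garsia's maximal inequality for the shift.
   Split g = g1 + g2 with g1 bounded and g2 small in L^1; put g0 = g1 - E g1.
   The average h of g0 over the first k coordinates is small in L^1 because its
   variance is O(1/k), and the ergodic averages of g0 and of h differ by O(k/n).
   The maximal inequality for |h| + |g2| then bounds the limit superior of
   |mean of g - E g| outside a set of small measure. *)

Require Import Defs.
From mathcomp Require Import all_boot all_order all_algebra.
From mathcomp Require Import all_classical all_reals all_analysis.
From mathcomp Require Import measurable_realfun.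
From mathcomp Require Import ring lra.

Set Implicit Arguments.
Unset Strict Implicit.
Unset Printing Implicit Defensive.

Import Order.TTheory GRing.Theory Num.Theory.
Import numFieldNormedType.Exports.

Local Open Scope classical_set_scope.
Local Open Scope ring_scope.

(** * Garsia's maximal inequality for a measure-preserving map *)

Section birkhoff_maximal_inequality.
Context d (T : measurableType d) (R : realType).
Variables (mu : {measure set T -> \bar R}) (tau : T -> T).
Hypothesis mtau : measurable_fun setT tau.
Hypothesis tau_mu : forall B, measurable B -> mu (tau @^-1` B) = mu B.

Lemma ge0_integral_comp_invariant (h : T -> \bar R) :
  measurable_fun setT h -> (forall x, 0 <= h x)%E ->
  (\int[mu]_x h (tau x) = \int[mu]_x h x)%E.
Proof.
move=> mh h0; transitivity (\int[pushforward mu tau]_x h x)%E.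
  by rewrite ge0_integral_pushforward ?preimage_setT.
by apply: eq_measure_integral => B mB _; exact: tau_mu.
Qed.

Variables (psi : T -> R) (lam : R).
Hypothesis mpsi : measurable_fun setT psi.
Hypothesis psi0 : forall x, 0 <= psi x.
Hypothesis lam0 : 0 < lam.

(* The maximum over k <= n of the k-th Birkhoff sum of [psi - lam]. *)
Fixpoint max_birkhoff_sum (n : nat) : T -> R :=
  if n is n'.+1 then
    fun x => Num.max 0 (psi x - lam + max_birkhoff_sum n' (tau x))
  else fun=> 0.

Local Notation M := max_birkhoff_sum.

Lemma max_birkhoff_sum_ge0 n x : 0 <= M n x.
Proof. by case: n => [|n] //=; rewrite le_max lexx. Qed.

Lemma max_birkhoff_sum_leS n x : M n x <= M n.+1 x.
Proof.
elim: n x => [|n IH] x; first exact: max_birkhoff_sum_ge0.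
by apply: le_max2 => //; rewrite lerD2l.
Qed.

Lemma birkhoff_sum_le_max n x :
  \sum_(k < n) psi (iter k tau x) - n%:R * lam <= M n x.
Proof.
elim: n x => [|n IH] x; first by rewrite big_ord0 mul0r subr0.
rewrite big_ord_recl le_max; apply/orP; right.
under eq_bigr do rewrite lift0 iterSr.
rewrite -[n.+1%:R]natr1 mulrDl mul1r [n%:R * _ + _]addrC opprD addrACA lerD2l.
exact: IH.
Qed.

Lemma measurable_max_birkhoff_sum n : measurable_fun setT (M n).
Proof.
elim: n => [|n IH] /=; first exact: measurable_cst.
apply: measurable_maxr; first exact: measurable_cst.
apply: measurable_funD; last exact: measurableT_comp.
by apply: measurable_funB.
Qed.

Let mEM n : measurable_fun setT (EFin \o M n).
Proof. by apply/measurable_EFinP; exact: measurable_max_birkhoff_sum. Qed.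

Let mEpsi : measurable_fun setT (EFin \o psi).
Proof. exact/measurable_EFinP. Qed.

(** This finiteness is what lets the integral of [M n.+1] be cancelled in Garsia's argument. *)
Lemma integral_max_birkhoff_sum_lty n : (\int[mu]_x (psi x)%:E < +oo)%E ->
  (\int[mu]_x (M n x)%:E < +oo)%E.
Proof.
move=> psioo; elim: n => [|n IH]; first by rewrite integral0.
have mMt : measurable_fun setT (EFin \o M n \o tau) by exact: measurableT_comp.
apply: (@le_lt_trans _ _ (\int[mu]_x ((psi x)%:E + (M n (tau x))%:E)))%E.
  apply: ge0_le_integral => //.
  - by move=> x _; rewrite lee_fin max_birkhoff_sum_ge0.
  - exact: mEM.
  - by apply: emeasurable_funD.
  - move=> x _; rewrite -EFinD lee_fin /= ge_max.
    rewrite addr_ge0 ?max_birkhoff_sum_ge0//=.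
    by rewrite lerD2r gerBl ltW.
rewrite ge0_integralD//=; last first.
- by move=> x _; rewrite lee_fin max_birkhoff_sum_ge0.
- by move=> x _; rewrite lee_fin.
rewrite (@ge0_integral_comp_invariant (EFin \o M n))//; last first.
  by move=> x; rewrite lee_fin max_birkhoff_sum_ge0.
by rewrite lte_add_pinfty.
Qed.

Let E n := [set x | 0 < M n x].

Let mE n : measurable (E n).
Proof.
have -> : E n = setT `&` M n @^-1` `]0, +oo[.
  by rewrite setTI; apply/seteqP; split => x /=; rewrite in_itv /= andbT.
exact: measurable_max_birkhoff_sum.
Qed.

(* Garsia's argument: on the set where [M n.+1] is positive it equals
   [psi - lam + M n \o tau], and the integrals of [M n] and [M n \o tau]
   agree. *)
Lemma measure_max_birkhoff_sum_gt0 n :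
  (lam%:E * mu [set x | (0 < M n x)%R] <= \int[mu]_x (psi x)%:E)%E.
Proof.
have [->|] := eqVneq (\int[mu]_x (psi x)%:E)%E +oo%E; first exact: leey.
rewrite -ltey => psioo.
case: n => [|n].
  rewrite (_ : [set x | _] = set0) ?measure0 ?mule0; last first.
    by apply/seteqP; split => x //=; rewrite ltxx.
  by apply: integral_ge0 => x _; rewrite lee_fin.
have Mn0 k x : (0 <= (M k x)%:E)%E by rewrite lee_fin max_birkhoff_sum_ge0.
have mMt : measurable_fun setT (EFin \o M n \o tau) by exact: measurableT_comp.
have m1 : measurable_fun setT (fun x => (lam * \1_(E n.+1) x)%:E).
  by apply/measurable_EFinP/measurable_funM.
have : (\int[mu]_x ((lam * \1_(E n.+1) x)%:E + (M n.+1 x)%:E) <=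
        \int[mu]_x ((psi x)%:E + (M n (tau x))%:E))%E.
  apply: ge0_le_integral => //.
  - by move=> x _; rewrite adde_ge0// lee_fin mulr_ge0// ltW.
  - by apply: emeasurable_funD => //; exact: mEM.
  - by apply: emeasurable_funD => //; exact: mEM.
  - move=> x _; rewrite -!EFinD lee_fin indicE /=.
    have := max_birkhoff_sum_ge0 n (tau x).
    have [ME|ME] := boolP (x \in E n.+1).
      have := set_mem ME; rewrite /E /= lt_max ltxx /= => gt0 _.
      by rewrite (max_idPr (ltW gt0)); lra.
    (* Off [E n.+1] the left side is [M n.+1 x <= 0], and the right side is nonnegative. *)
    move=> Mt0; rewrite mulr0 add0r.
    move: ME; rewrite notin_setE /E /= => /negP; rewrite -leNgt => /le_trans.
    by apply; rewrite addr_ge0.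
rewrite [leLHS]ge0_integralD//; last 2 first.
- by move=> x _; rewrite lee_fin mulr_ge0// ltW.
- exact: mEM n.+1.
rewrite [leRHS]ge0_integralD//; last by move=> x _; rewrite lee_fin.
rewrite (@ge0_integral_comp_invariant (EFin \o M n))//; last first.
  by move=> x; exact: Mn0.
under eq_integral do rewrite EFinM.
rewrite ge0_integralZl//=; last first.
- by rewrite lee_fin ltW.
- by apply/measurable_EFinP.
rewrite integral_indic// setIT => le1.
have Moo := integral_max_birkhoff_sum_lty n.+1 psioo.
rewrite -(@leeD2rE _ (\int[mu]_x (M n.+1 x)%:E)%E); last first.
  by rewrite ge0_fin_numE// integral_ge0.
apply: (le_trans le1); apply: leeD2l; apply: ge0_le_integral => //.
- exact: mEM n.
- exact: mEM n.+1.
- by move=> x _; rewrite lee_fin; exact: max_birkhoff_sum_leS.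
Qed.

(** One set serves all [n]: the union of the sets where [M n] is positive. These increase with [n],
    so continuity from below carries the bound over to the union. *)
Lemma birkhoff_maximal_inequality : exists B, [/\ measurable B,
    forall x (n : nat),
      n%:R * lam < \sum_(k < n) psi (iter k tau x) -> B x &
    (lam%:E * mu B <= \int[mu]_x (psi x)%:E)%E].
Proof.
have mB : measurable (\bigcup_n E n) by exact: bigcupT_measurable.
exists (\bigcup_n E n); split => // [x n ltS|].
  exists n => //; apply: lt_le_trans (birkhoff_sum_le_max n x).
  by rewrite subr_gt0.
have cvgE : (lam%:E * mu (E n) @[n --> \oo] --> lam%:E * mu (\bigcup_n E n))%E.
  apply: cvgeZl => //; apply: nondecreasing_cvg_mu => // i j ij.
  apply/subsetPset => x /lt_le_trans; apply.
  by have /nondecreasing_seqP := max_birkhoff_sum_leS^~ x; apply.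
rewrite -(cvg_lim _ cvgE)//; apply: lime_le; first exact: (cvgP _ cvgE).
by apply: nearW => n; exact: measure_max_birkhoff_sum_gt0.
Qed.

End birkhoff_maximal_inequality.

(** * Integrals of bounded functions under a probability measure *)

Lemma bounded_integrable d (T : measurableType d) (R : realType)
    (mu : probability T R) (h : T -> R) (C : R) : measurable_fun setT h ->
  (forall x, `|h x| <= C) -> mu.-integrable setT (EFin \o h).
Proof.
move=> mh hC; apply: measurable_bounded_integrable => //.
  by rewrite (le_lt_trans (probability_le1 mu measurableT)) ?ltry.
exists C; split; first exact: num_real.
by move=> y Cy x _; exact: le_trans (hC x) (ltW Cy).
Qed.

Lemma probability_integral_cst d (T : measurableType d) (R : realType)
    (mu : probability T R) (c : R) : (\int[mu]_x c%:E = c%:E)%E.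
Proof.
by rewrite integral_cst//; have /= -> := probability_setT mu; rewrite mule1.
Qed.

Lemma integral_le_cst d (T : measurableType d) (R : realType)
    (mu : probability T R) (h : T -> R) (c : R) :
  mu.-integrable setT (EFin \o h) -> (forall x, h x <= c) ->
  (\int[mu]_x (h x)%:E <= c%:E)%E.
Proof.
move=> inth hc; rewrite -[leRHS](probability_integral_cst mu c).
apply: le_integral => //; last by move=> x _; rewrite lee_fin.
by apply: (@bounded_integrable _ _ _ _ (fun=> c) `|c|).
Qed.

(** * The shift and the coordinates under the product measure *)

Section product_measure.
Variables (R : realType) (P : probability R R) (Q : probability (seqR R) R).
Hypothesis QP : is_product_measure P Q.

Definition shift_seq (w : seqR R) : seqR R := fun k => w k.+1.

Lemma iter_shift_seq n w k : iter n shift_seq w k = w (n + k)%N.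
Proof. by elim: n k => //= n IH k; rewrite /shift_seq IH addnS. Qed.

Lemma measurable_coord k : measurable_fun setT (fun w : seqR R => w k).
Proof.
by move=> _ A mA; apply: sub_sigma_algebra; exists k => //; exists A.
Qed.

Lemma measurable_shift_seq : measurable_fun setT shift_seq.
Proof.
refine (@measurability _ _ (seqR R) (seqR R) setT shift_seq
  (@coord_measurable R) erefl _).
move=> _ [_ [k _ [A mA <-]] <-].
by rewrite !setTI; have := measurable_coord k.+1 measurableT mA; rewrite setTI.
Qed.

Definition box n (A : nat -> set R) : set (seqR R) :=
  [set w | forall k, (k < n)%N -> A k (w k)].

Lemma measurable_box n A : (forall k, measurable (A k)) -> measurable (box n A).
Proof.
move=> mA; rewrite (_ : box n A =
  \bigcap_(k < n) ((fun w : seqR R => w k) @^-1` A k)) //.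
apply: bigcap_measurableType => k _.
by have := measurable_coord k measurableT (mA k); rewrite setTI.
Qed.

(** The boxes form a pi-system that generates the sigma-algebra. The preimage of a box under the
    shift is a box with one more factor in front, the whole line, which has probability one; so both
    measures agree on boxes. *)
Lemma shift_seq_invariant B : measurable B -> Q (shift_seq @^-1` B) = Q B.
Proof.
pose G : set (set (seqR R)) :=
  [set C | exists n A, (forall k, measurable (A k)) /\ C = box n A].
have GT : G setT.
  exists 0%N, (fun=> setT); split => //.
  by apply/seteqP; split => w // _ k; rewrite ltn0.
have mG : @measurable _ (seqR R) = <<s G >>.
  apply/seteqP; split.
    apply: smallest_sub; first exact: smallest_sigma_algebra.
    move=> _ [k _ [A mA <-]]; apply: sub_sigma_algebra; rewrite setTI.
    (* A condition on coordinate [k] alone is a box of length [k + 1] with the whole line in all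
       earlier factors. *)
    exists k.+1, (fun i => if i == k then A else setT); split.
      by move=> i; case: ifP.
    apply/seteqP; split => w /=.
      by move=> Aw i _; case: eqP => // ->.
    by move/(_ k (ltnSn k)); rewrite eqxx.
  apply: smallest_sub; first exact: smallest_sigma_algebra.
  by move=> _ [n [A [mA ->]]]; exact: measurable_box.
move=> mB; change (pushforward Q shift_seq B = Q B).
apply: (measure_unique G (fun=> setT)) mB => //.
- move=> _ _ [n [A [mA ->]]] [m [A' [mA' ->]]].
  exists (maxn n m), (fun k => (if (k < n)%N then A k else setT) `&`
    (if (k < m)%N then A' k else setT)); split.
    by move=> k; apply: measurableI; case: ifP.
  apply/seteqP; split => w /=.
    by move=> [Aw A'w] k _; split; case: ifP => // /[dup];
       [move=> _ /Aw|move=> _ /A'w].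
  move=> H; split => k km.
    by have := H k; rewrite leq_max km => /(_ isT)[].
  by have := H k; rewrite leq_max km orbT => /(_ isT)[].
- by rewrite bigcup_const//; exists 0%N.
- exact: measurable_shift_seq.
- move=> mshift _ [n [A [mA ->]]]; rewrite [RHS]QP//.
  pose A' k := if k is k'.+1 then A k' else setT.
  transitivity (\prod_(k < n.+1) P (A' k))%E; last first.
    by rewrite big_ord_recl /= probability_setT mul1e.
  have mA' k : measurable (A' k)
    by case: k => [|k] /=; [exact: measurableT|exact: mA].
  rewrite -(QP n.+1)//.
  congr (Q _); apply/seteqP; split => w /= H.
    by case=> // k /H.
  by move=> k kn; exact: (H k.+1).
- move=> mshift _; apply: (@le_lt_trans _ _ 1%E); last exact: ltry.
  by rewrite /= /pushforward preimage_setT probability_setT.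
Qed.

Lemma product_measure_pair i j A B : i != j -> measurable A -> measurable B ->
  Q [set w | A (w i) /\ B (w j)] = (P A * P B)%E.
Proof.
move=> ij mA mB.
pose C k := if k == i then A else if k == j then B else setT.
have mC k : measurable (C k) by rewrite /C; do 2 case: ifP => // _.
have -> : [set w : seqR R | A (w i) /\ B (w j)] = box (maxn i j).+1 C.
  apply/seteqP; split => w /=.
    move=> [Aw Bw] k _; rewrite /C.
    by case: eqP => [->//|_]; case: eqP => [->|].
  move=> H; split.
    by have := H i; rewrite ltnS leq_maxl /C eqxx; apply.
  by have := H j; rewrite ltnS leq_maxr /C eqxx eq_sym (negbTE ij); apply.
rewrite QP//.
have i_lt : (i < (maxn i j).+1)%N by rewrite ltnS leq_maxl.
have j_lt : (j < (maxn i j).+1)%N by rewrite ltnS leq_maxr.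
rewrite (bigD1 (Ordinal i_lt))//= (bigD1 (Ordinal j_lt))/=; last first.
  by rewrite -val_eqE /= eq_sym.
rewrite big1 ?mule1; last first.
  move=> k; rewrite -!val_eqE /= /C => /andP[/negbTE-> /negbTE->].
  exact: probability_setT.
by rewrite /C eqxx (eq_sym j) (negbTE ij) eqxx.
Qed.

Lemma product_measure_coord i A : measurable A ->
  Q [set w | A (w i)] = P A.
Proof.
(* The next coordinate serves as a second one on which nothing is required. *)
move=> mA; have ii : i != i.+1 by rewrite neq_ltn ltnSn.
have := product_measure_pair ii mA measurableT.
rewrite probability_setT mule1 => <-.
by congr (Q _); apply/seteqP; split => w //= [].
Qed.

Lemma ge0_integral_coord i (h : R -> \bar R) : measurable_fun setT h ->
  (forall x, 0 <= h x)%E -> (\int[Q]_w h (w i) = \int[P]_x h x)%E.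
Proof.
move=> mh h0.
transitivity (\int[pushforward Q (fun w : seqR R => w i)]_x h x)%E.
  by rewrite ge0_integral_pushforward ?preimage_setT//; exact: measurable_coord.
apply: eq_measure_integral => [|mi B mB _]; first exact: measurable_coord.
exact: product_measure_coord.
Qed.

Variables (g : R -> R) (C : R).
Hypothesis mg : measurable_fun setT g.
Hypothesis gC : forall x, `|g x| <= C.
Hypothesis g_int0 : (\int[P]_x (g x)%:E = 0)%E.

(** Distinct coordinates have joint law [P \x P], so Fubini's theorem reduces the integral to the
    mean of [g], which is zero. *)
Lemma integral_mul_coord i j : i != j ->
  (\int[Q]_w (g (w i) * g (w j))%:E = 0)%E.
Proof.
move=> ij.
pose h (z : R * R) := (g z.1 * g z.2)%:E.
have mh : measurable_fun setT h.
  by apply/measurable_EFinP/measurable_funM; apply: measurableT_comp.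
pose pij (w : seqR R) := (w i, w j).
have mpij : measurable_fun setT pij.
  by apply: measurable_fun_pair; exact: measurable_coord.
have hint d (T : measurableType d) (mu : probability T R) (p : T -> R * R) :
    measurable_fun setT p -> mu.-integrable setT (h \o p).
  move=> mp; apply: (@bounded_integrable _ _ _ _ _ (C * C)).
    by apply: measurable_funM; apply: measurableT_comp => //;
       apply: measurableT_comp.
  by move=> x; rewrite normrM ler_pM.
transitivity (\int[pushforward Q pij]_z h z)%E.
  by rewrite integral_pushforward//; exact: hint.
transitivity (\int[P \x P]_z h z)%E.
  apply: eq_measure_integral => // D mD _.
  apply/esym/product_measure_unique => //.
  by move=> A B mA mB; rewrite -(product_measure_pair ij mA mB).
rewrite -integral12_prod_meas1; last first.
  by apply: (hint _ _ _ id).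
rewrite (eq_integral (cst 0%E)) ?integral0// => x _.
rewrite /fubini_F /h /=; under eq_integral do rewrite EFinM.
rewrite integralZl//; last exact: bounded_integrable gC.
by rewrite g_int0 mule0.
Qed.

Lemma integral_mul_partial_sum k j : (k <= j)%N ->
  (\int[Q]_w (\sum_(i < k) (g (w i) * g (w j)))%:E = 0)%E.
Proof.
move=> kj; under eq_integral do rewrite -sumEFin.
rewrite integral_sum//= => [|i].
  rewrite big1// => i _; rewrite integral_mul_coord//.
  by rewrite neq_ltn (leq_trans (ltn_ord i)).
apply: (@bounded_integrable _ _ _ _ _ (C * C)) => [|w].
  by apply: measurable_funM; apply: measurableT_comp => //;
     exact: measurable_coord.
by rewrite normrM ler_pM.
Qed.

(** Since the cross terms vanish, each further summand adds at most [C ^+ 2] to the second moment,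
    which therefore grows linearly in [k]. *)
Lemma integral_sqr_partial_sum k :
  (\int[Q]_w ((\sum_(i < k) g (w i)) ^+ 2)%:E <= (k%:R * C ^+ 2)%:E)%E.
Proof.
pose S k (w : seqR R) := \sum_(i < k) g (w i).
have C0 : 0 <= C by exact: le_trans (gC 0).
have mgc i : measurable_fun setT (fun w : seqR R => g (w i)).
  by apply: measurableT_comp => //; exact: measurable_coord.
have mS n : measurable_fun setT (S n) by apply: measurable_sum.
have SC n w : `|S n w| <= n%:R * C.
  apply: le_trans (ler_norm_sum _ _ _) _.
  rewrite (_ : n%:R * C = \sum_(i < n) C) ?ler_sum//.
  by rewrite sumr_const card_ord mulr_natl.
elim: k => [|k IH].
  rewrite mul0r; under eq_integral do rewrite big_ord0 expr0n.
  by rewrite integral0.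
have int1 : Q.-integrable setT (EFin \o (fun w : seqR R => S k w ^+ 2)).
  apply: (@bounded_integrable _ _ _ _ _ ((k%:R * C) ^+ 2)) => [|w].
    exact: measurable_funX.
  by rewrite normrX lerXn2r ?nnegrE ?mulr_ge0.
have int2 : Q.-integrable setT
    (EFin \o (fun w : seqR R => \sum_(i < k) (g (w i) * g (w k)))).
  apply: (@bounded_integrable _ _ _ _ _ (k%:R * C * C)) => [|w].
    by apply: measurable_sum => i; apply: measurable_funM.
  by rewrite -mulr_suml normrM ler_pM ?SC.
have int3 : Q.-integrable setT (EFin \o (fun w : seqR R => g (w k) ^+ 2)).
  apply: (@bounded_integrable _ _ _ _ _ (C ^+ 2)) => [|w].
    exact: measurable_funX.
  by rewrite normrX lerXn2r ?nnegrE.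
rewrite (eq_integral (fun w => (S k w ^+ 2)%:E +
    (2%:E * (\sum_(i < k) (g (w i) * g (w k)))%:E + (g (w k) ^+ 2)%:E))%E);
  last first.
  move=> w _; rewrite big_ord_recr /= -EFinM -!EFinD; congr EFin.
  by rewrite -mulr_suml -/(S k w); ring.
rewrite integralD//=; last by apply: integrableD => //; exact: integrableZl.
rewrite integralD//=; last exact: integrableZl.
rewrite integralZl//= integral_mul_partial_sum// mule0 add0e.
rewrite -natr1 mulrDl mul1r EFinD; apply: leeD => //.
apply: integral_le_cst => // w.
by rewrite -(@real_normK _ (g _)) ?num_real// lerXn2r ?nnegrE.
Qed.

(** The average has second moment at most [C ^+ 2 / k], and this bounds its L^1 norm by
    [delta / 2 + C ^+ 2 / (2 * delta * k)]. *)
Lemma L1_small_average (delta : R) : 0 < delta -> exists2 k, (0 < k)%N &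
  (\int[Q]_w `|k%:R^-1 * \sum_(i < k) g (w i)|%:E <= delta%:E)%E.
Proof.
(* This [k] exceeds [C ^+ 2 / delta ^+ 2], so the second-moment term costs at most [delta / 2]. *)
move=> d0; exists (Num.truncn (C ^+ 2 / delta ^+ 2)).+1 => //.
set k := _.+1.
have kC : C ^+ 2 <= k%:R * delta ^+ 2.
  by rewrite -ler_pdivrMr ?exprn_gt0// ltW// /k truncnS_gt.
pose h (w : seqR R) := k%:R^-1 * \sum_(i < k) g (w i).
have mh : measurable_fun setT h.
  apply: measurable_funM => //; apply: measurable_sum => i.
  by apply: measurableT_comp => //; exact: measurable_coord.
have mS2 : measurable_fun setT
    (fun w : seqR R => ((\sum_(i < k) g (w i)) ^+ 2)%:E).
  apply/measurable_EFinP/measurable_funX; apply: measurable_sum => i.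
  by apply: measurableT_comp => //; exact: measurable_coord.
pose a := (2 * delta)^-1 * k%:R^-1 ^+ 2.
have a0 : 0 <= a by rewrite mulr_ge0 ?sqr_ge0// invr_ge0 mulr_ge0// ltW.
(* AM-GM: [2 delta |h| <= delta^2 + h^2]. *)
have hle : (\int[Q]_w `|h w|%:E <= \int[Q]_w ((delta / 2)%:E +
    a%:E * ((\sum_(i < k) g (w i)) ^+ 2)%:E))%E.
  apply: ge0_le_integral => //.
  - by apply/measurable_EFinP; exact: measurableT_comp.
  - by apply: emeasurable_funD => //; exact: emeasurable_funM.
  - move=> w _; rewrite -EFinM -EFinD lee_fin -mulrA -exprMn -/(h w).
    rewrite -[h w ^+ 2]real_normK ?num_real//.
    rewrite -subr_ge0 (_ : _ - _ = (2 * delta)^-1 * (`|h w| - delta) ^+ 2).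
      by rewrite mulr_ge0 ?sqr_ge0// invr_ge0 mulr_ge0// ltW.
    by field; rewrite gt_eqF.
apply: (le_trans hle); rewrite ge0_integralD//=; last 3 first.
- by move=> w _; rewrite lee_fin divr_ge0// ltW.
- by move=> w _; rewrite -EFinM lee_fin mulr_ge0 ?sqr_ge0.
- exact: emeasurable_funM.
rewrite probability_integral_cst ge0_integralZl//=; last first.
  by move=> w _; rewrite lee_fin sqr_ge0.
apply: (@le_trans _ _ ((delta / 2)%:E + a%:E * (k%:R * C ^+ 2)%:E)%E).
  apply: leeD2l; apply: lee_pmul => //; last exact: integral_sqr_partial_sum.
  by apply: integral_ge0 => w _; rewrite lee_fin sqr_ge0.
rewrite -EFinM -EFinD lee_fin.
have k0 : 0 < k%:R :> R by rewrite ltr0n.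
rewrite -subr_ge0 (_ : _ - _ =
    (2 * delta)^-1 * k%:R^-1 * (k%:R * delta ^+ 2 - C ^+ 2)).
  by rewrite mulr_ge0 ?subr_ge0// mulr_ge0 ?invr_ge0 ?ler0n// mulr_ge0// ltW.
by rewrite /a; field; rewrite !gt_eqF.
Qed.

End product_measure.

(** * Replacing the terms of a long sum by short averages *)

Lemma shifted_sum_close (R : realType) (a : nat -> R) (C : R) n j :
  (forall i, `|a i| <= C) ->
  `|\sum_(i < n) a i - \sum_(i < n) a (i + j)%N| <= 2 * C * j%:R.
Proof.
move=> aC; elim: j => [|j IH].
  by under [X in _ - X]eq_bigr do rewrite addn0; rewrite subrr normr0 mulr0.
(* Moving the window one place to the right gains [a (n + j)] and loses [a j], at a cost of at most
   [2 * C]. *)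
have -> : \sum_(i < n) a (i + j.+1)%N =
    \sum_(i < n) a (i + j)%N + (a (n + j)%N - a j).
  have E : \sum_(i < n) a (i + j)%N + a (n + j)%N =
      a j + \sum_(i < n) a (i + j.+1)%N.
    rewrite -(big_ord_recr n (fun i : 'I_n.+1 => a (i + j)%N)) /= big_ord_recl.
    by congr (_ + _); apply: eq_bigr => i _; rewrite lift0 addSnnS.
  by rewrite addrA E addrAC subrr add0r.
rewrite opprD addrA (le_trans (ler_normB _ _))// -[j.+1%:R]natr1 mulrDr mulr1.
apply: lerD => //; apply: (le_trans (ler_normB _ _)).
by rewrite mulr_natl mulr2n lerD.
Qed.

(** The sum of averages is the mean of [k] shifted copies of the original sum; each is off by at
    most [2 * C * k], whatever [n] is. *)
Lemma sum_average_close (R : realType) (a : nat -> R) (C : R) n k :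
  (0 < k)%N -> (forall i, `|a i| <= C) ->
  `|\sum_(i < n) a i - \sum_(i < n) (k%:R^-1 * \sum_(j < k) a (i + j)%N)|
    <= 2 * C * k%:R.
Proof.
move=> k0 aC; have k0R : 0 < k%:R :> R by rewrite ltr0n.
have C0 : 0 <= C by exact: le_trans (aC 0%N).
rewrite -mulr_sumr exchange_big /=.
have -> : \sum_(i < n) a i = k%:R^-1 * \sum_(j < k) \sum_(i < n) a i.
  by rewrite sumr_const card_ord -[X in _ = _ * X]mulr_natl mulKf// gt_eqF.
rewrite -mulrBr -sumrB normrM ger0_norm ?invr_ge0// ler_pdivrMl//.
apply: (le_trans (ler_norm_sum _ _ _)).
apply: (@le_trans _ _ (\sum_(j < k) (2 * C * k%:R))); last first.
  by rewrite sumr_const card_ord -[leLHS]mulr_natl.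
apply: ler_sum => j _; apply: (le_trans (shifted_sum_close n j aC)).
by rewrite ler_wpM2l ?mulr_ge0// ler_nat ltnW.
Qed.

(** * The strong law of large numbers *)

Section strong_law_of_large_numbers.
Variables (R : realType) (P : probability R R) (Q : probability (seqR R) R).
Hypothesis QP : is_product_measure P Q.
Variable g : R -> R.
Hypothesis intg : P.-integrable setT (EFin \o g).

Import HBSimple.

Let c := fine (\int[P]_x (g x)%:E)%E.

(** The three errors of size [eps] are the change of the mean from [g] to [g1], the Birkhoff average
    of [psi] outside [B], and the boundary terms from replacing [g0] by its short averages. *)
Lemma large_deviation_set (eps delta : R) : 0 < eps -> 0 < delta ->
  exists B, [/\ measurable B, (Q B <= delta%:E)%E &
    forall w, ~ B w -> \forall n \near \oo,
      `|n%:R^-1 * \sum_(k < n) g (w k) - c| <= 3 * eps].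
Proof.
(* The bound [eps] controls the change of the mean; the bound [delta * eps / 2] brings the integral
   of [psi], which is at most [2 * eta], below [delta * eps], as the maximal inequality at level
   [eps] requires. *)
move=> e0 d0; pose eta := Num.min eps (delta * eps / 2).
have eta0 : 0 < eta by rewrite lt_min e0/= divr_gt0// mulr_gt0.
have [g1 [ig1 gL1]] : exists g1 : {sfun R >-> R},
    P.-integrable setT (EFin \o g1) /\
    (\int[P]_x `|(g x)%:E - (g1 x)%:E| < eta%:E)%E.
  have [g_ [ig_ _ cvg_]] := approximation_sfun_integrable measurableT intg.
  have : \forall n \near \oo, (\int[P]_x `|(g x)%:E - (g_ n x)%:E| < eta%:E)%E.
    have /fine_cvgP[fin_ /cvgr_lt/(_ _ eta0)] := cvg_.
    by apply: filterS2 fin_ => n fn; rewrite -lte_fin /= fineK.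
  by move=> [n _ /(_ n (leqnn n)) Hn]; exists (g_ n).
have [C0 [_ g1C0]] := simple_bounded g1.
(* [simple_bounded] yields a bound only for numbers above [C0]. *)
pose C1 := C0 + 1.
have g1C x : `|g1 x| <= C1 by apply: g1C0 => //; rewrite ltrDl.
pose c1 := fine (\int[P]_x (g1 x)%:E)%E.
have c1E : (\int[P]_x (g1 x)%:E = c1%:E)%E.
  by rewrite fineK// integrable_fin_num.
have cE : (\int[P]_x (g x)%:E = c%:E)%E.
  by rewrite fineK// integrable_fin_num.
have cc1 : `|c1 - c| <= eta.
  rewrite distrC -lee_fin; apply: le_trans (ltW gL1).
  rewrite -abse_EFin EFinB -cE -c1E -integralB_EFin//.
  apply: le_abse_integral => //.
  by apply: emeasurable_funB;
     [exact: measurable_int intg|exact: measurable_int ig1].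
pose g0 x := g1 x - c1.
have mg0 : measurable_fun setT g0 by apply: measurable_funB.
pose C := C1 + `|c1|.
have g0C x : `|g0 x| <= C by apply: le_trans (ler_normB _ _) _; rewrite lerD2r.
have g00 : (\int[P]_x (g0 x)%:E = 0)%E.
  under eq_integral do rewrite EFinB.
  rewrite integralB_EFin//; last first.
    by apply: (@bounded_integrable _ _ _ _ (fun=> c1) `|c1|).
  by rewrite c1E probability_integral_cst subee.
have [k k0 hL1] := L1_small_average QP mg0 g0C g00 eta0.
pose h (w : seqR R) := k%:R^-1 * \sum_(j < k) g0 (w j).
have mcoord (u : R -> R) i : measurable_fun setT u ->
    measurable_fun setT (fun w : seqR R => u (w i)).
  by move=> mu; apply: measurableT_comp => //; exact: measurable_coord.
have mh : measurable_fun setT h.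
  by apply: measurable_funM => //; apply: measurable_sum => i; exact: mcoord.
have mg : measurable_fun setT g.
  by apply/measurable_EFinP; exact: measurable_int intg.
pose g2 x : R := `|g x - g1 x|.
have mg2 : measurable_fun setT g2.
  by apply: measurableT_comp => //; apply: measurable_funB.
(* Along the shift orbit [h] gives the short averages of [g0], and [g2] the approximation errors, so
   one maximal inequality controls both. *)
pose psi (w : seqR R) : R := `|h w| + g2 (w 0%N).
have mpsi : measurable_fun setT psi.
  by apply: measurable_funD; [exact: measurableT_comp|exact: mcoord].
have psi0 w : 0 <= psi w by rewrite addr_ge0 ?normr_ge0.
have [B [mB HB QB]] := birkhoff_maximal_inequality (@measurable_shift_seq R)
  (shift_seq_invariant QP) mpsi psi0 e0.
have psiL1 : (\int[Q]_w (psi w)%:E <= (2 * eta)%:E)%E.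
  under eq_integral do rewrite EFinD.
  rewrite ge0_integralD//; last 3 first.
  - by apply/measurable_EFinP/measurableT_comp.
  - by move=> w _; rewrite lee_fin normr_ge0.
  - by apply/measurable_EFinP; exact: (mcoord g2).
  rewrite mulr_natl mulr2n EFinD leeD//.
  rewrite (ge0_integral_coord QP 0 (h := EFin \o g2))//; last 2 first.
  - exact/measurable_EFinP.
  - by move=> x; rewrite lee_fin normr_ge0.
  exact: ltW.
exists B; split => //.
  rewrite -(@lee_pmul2l _ eps%:E)//.
  apply: (le_trans QB); apply: (le_trans psiL1); rewrite -EFinM lee_fin.
  have : eta <= delta * eps / 2 by rewrite ge_min lexx orbT.
  lra.
move=> w Bw.
near=> n.
have n0 : 0 < n%:R :> R by rewrite ltr0n; near: n; exists 1%N.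
have psiw : \sum_(i < n) psi (iter i (@shift_seq R) w) <= n%:R * eps.
  by rewrite leNgt; apply/negP => /HB.
have rest := sum_average_close n k0 (fun i => g0C (w i)).
have -> : n%:R^-1 * \sum_(i < n) g (w i) - c = n%:R^-1 *
    (\sum_(i < n) (g (w i) - g1 (w i)) + \sum_(i < n) g0 (w i)) + (c1 - c).
  rewrite -big_split /= [in RHS](eq_bigr (fun i : 'I_n => g (w i) - c1)).
    rewrite sumrB sumr_const card_ord mulrBr -[c1 *+ n]mulr_natl.
    rewrite mulKf ?gt_eqF//.
    by ring.
  by move=> i _; rewrite /g0; ring.
apply: (le_trans (ler_normD _ _)).
rewrite (_ : 3 * eps = 2 * eps + eps); last by ring.
apply: lerD; last by rewrite (le_trans cc1)// ge_min lexx.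
rewrite normrM ger0_norm ?invr_ge0 ?(ltW n0)// ler_pdivrMl//.
(* The boundary error does not depend on [n], so [n%:R * eps] eventually absorbs it. *)
have Cn : 2 * C * k%:R <= n%:R * eps.
  rewrite -ler_pdivrMr//; near: n; exact: nbhs_infty_ger.
rewrite (_ : _ * (2 * eps) = n%:R * eps + n%:R * eps); last by ring.
apply: le_trans (lerD psiw (le_trans rest Cn)).
have iter0 i : iter i (@shift_seq R) w 0%N = w i.
  by rewrite iter_shift_seq addn0.
have iterh i : h (iter i (@shift_seq R) w) =
    k%:R^-1 * \sum_(j < k) g0 (w (i + j)%N).
  by congr (_ * _); apply: eq_bigr => j _; rewrite iter_shift_seq.
have psiE i : psi (iter i (@shift_seq R) w) =
    `|k%:R^-1 * \sum_(j < k) g0 (w (i + j)%N)| + `|g (w i) - g1 (w i)|.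
  by rewrite /psi iterh /g2 iter0.
under [X in _ <= X + _]eq_bigr do rewrite psiE.
rewrite [X in _ <= X + _]big_split /= -addrA addrCA.
apply: (le_trans (ler_normD _ _)); apply: lerD; first exact: ler_norm_sum.
set G := \sum_(i < n) g0 (w i).
set H := \sum_(i < n) (k%:R^-1 * \sum_(j < k) g0 (w (i + j)%N)).
(* [H] is the sum of [h] along the orbit, bounded by the sum of its absolute values; [G - H] is the
   boundary error. *)
have {1}-> : G = H + (G - H) by rewrite addrCA subrr addr0.
apply: (le_trans (ler_normD _ _)); apply: lerD => //; exact: ler_norm_sum.
Unshelve. all: by end_near. Qed.

(** For each tolerance the bad set lies in an intersection of sets of measure at most [1 / (j + 1)],
    hence is negligible; countably many tolerances suffice for convergence. *)
Lemma strong_law_of_large_numbers :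
  {ae Q, forall w : seqR R, n%:R^-1 * \sum_(k < n) g (w k) @[n --> \oo] --> c}.
Proof.
have negl p : Q.-negligible [set w : seqR R | ~ \forall n \near \oo,
      `|n%:R^-1 * \sum_(k < n) g (w k) - c| <= 3 * p.+1%:R^-1].
  have p0 : 0 < p.+1%:R^-1 :> R by rewrite invr_gt0.
  have inv0 (j : nat) : 0 < j.+1%:R^-1 :> R by rewrite invr_gt0.
  have /choice[B HB] := fun j : nat => large_deviation_set p0 (inv0 j).
  have mB : measurable (\bigcap_j B j).
    by apply: bigcapT_measurable => j; have [] := HB j.
  exists (\bigcap_j B j); split => //; last first.
    move=> w /= bad j _; apply: contrapT => Bw; apply: bad.
    by have [_ _ ] := HB j; apply.
  apply/eqP; rewrite -measure_le0; apply/lee_addgt0Pr => e e0; rewrite add0e.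
  have [j je] : exists j : nat, j.+1%:R^-1 < e.
    near \oo => j; exists j; near: j; exact: near_infty_natSinv_lt (PosNum e0).
  have [mBj QBj _] := HB j.
  apply: (@le_trans _ _ (Q (B j))).
    by apply: le_measure; rewrite ?inE//; exact: bigcap_inf.
  by apply: (le_trans QBj); rewrite lee_fin ltW.
have := @ae_foralln _ _ _ Q (fun p w => \forall n \near \oo,
      `|n%:R^-1 * \sum_(k < n) g (w k) - c| <= 3 * p.+1%:R^-1) negl.
apply: filterS => w Hw; apply/cvgrPdist_le => e e0.
have [p pe] : exists p : nat, p.+1%:R^-1 < e / 3.
  have e30 : 0 < e / 3 by rewrite divr_gt0.
  near \oo => p; exists p; near: p; exact: near_infty_natSinv_lt (PosNum e30).
apply: filterS (Hw p) => n; rewrite distrC => /le_trans; apply.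
by rewrite mulrC -ler_pdivlMr// ltW.
Unshelve. all: by end_near. Qed.

End strong_law_of_large_numbers.

(** * Arbitrary norms and finite nets in finite dimension *)

Section norm_on_row_vectors.
Variables (R : realType) (m : nat) (N : 'rV[R]_m -> R).
Hypothesis N_norm : is_norm N.

Lemma is_norm0 : N 0 = 0.
Proof. by case: N_norm => _ NZ _; rewrite -(scale0r 0) NZ normr0 mul0r. Qed.

Lemma is_norm_ge0 x : 0 <= N x.
Proof.
case: (N_norm) => ND NZ _; have := ND x (- x).
rewrite subrr is_norm0 -[- x]scaleN1r NZ normrN1 mul1r; lra.
Qed.

(** Expanding [x] in the standard basis gives the sum of the norms of the basis vectors as a
    constant, since each coordinate is at most the canonical max norm. Adding one makes the constant
    positive, so that it can be divided by. *)
Lemma is_norm_le_mx_norm : exists2 K, 0 < K & forall x, N x <= K * `|x|.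
Proof.
case: (N_norm) => ND NZ _.
pose K := \sum_j N (delta_mx 0 j).
have K0 : 0 <= K by apply: sumr_ge0 => j _; exact: is_norm_ge0.
exists (K + 1) => [|x]; first by rewrite ltr_pwDr.
apply: (@le_trans _ _ (K * `|x|)); last by rewrite ler_wpM2r ?lerDl.
rewrite {1}[x]row_sum_delta.
have Nsum (r : seq 'I_m) (v : 'I_m -> 'rV[R]_m) :
    N (\sum_(j <- r) v j) <= \sum_(j <- r) N (v j).
  elim: r => [|j r IH]; first by rewrite !big_nil is_norm0.
  by rewrite !big_cons (le_trans (ND _ _))// lerD2l.
apply: (le_trans (Nsum _ _)); rewrite mulr_suml; apply: ler_sum => j _.
rewrite NZ mulrC ler_wpM2l ?is_norm_ge0//.
rewrite [leRHS]/Num.Def.normr /= mx_normrE; apply/bigmax_geP; right => /=.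
by exists (0, j).
Qed.

(** The closure of [T] is compact and is covered by the balls centred in [T], so a finite subcover
    has its centres in [T], where the assumptions on [f_] hold. *)
Lemma bounded_finite_net (T : set 'rV[R]_m) (eps : R) : bounded_set T ->
  0 < eps -> exists2 s : seq 'rV[R]_m, (forall u, u \in s -> T u) &
    forall t, T t -> exists2 u, u \in s & N (t - u) <= eps.
Proof.
move=> T_bounded e0; have [K K0 NK] := is_norm_le_mx_norm.
have Tco : compact (closure T).
  apply: bounded_closed_compact; last exact: closed_closure.
  have [M [Mreal TM]] := T_bounded.
  (* A point of the closure is within distance one of [T], so the bound grows by at most one. *)
  exists (M + 1); split; first exact: num_real.
  move=> x Mx y /(_ _ (nbhsx_ballx y 1 ltr01)) [t [Tt]].
  rewrite -ball_normE /= => yt.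
  rewrite -(subrK t y) (le_trans (ler_normD _ _))//.
  have := TM (x - 1) _ t Tt; rewrite ltrBrDr => /(_ Mx) /=; lra.
have d0 : 0 < eps / K by rewrite divr_gt0.
move: Tco; rewrite compact_cover => /(_ _ T (fun t => ball t (eps / K))) [].
- by move=> t Tt; exact: ball_open.
- move=> x /(_ _ (nbhsx_ballx x _ d0)) [t [Tt xt]].
  by exists t => //; exact: ball_sym.
move=> D DT Tcov; exists (finmap.enum_fset D) => [u uD|t Tt].
  by have := DT _ uD; rewrite inE.
have [u uD] := Tcov _ (subset_closure Tt).
rewrite -ball_normE /= => tu; exists u => //.
by rewrite (le_trans (NK _))// mulrC -ler_pdivlMr// distrC ltW.
Qed.
End norm_on_row_vectors.

(** * Distance of infima, minimal covers and limits of nonnegative sequences *)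

Lemma ereal_inf_dist_le (R : realType) (I : Type) (T : set I)
    (a b : I -> R) (c : R) :
  ereal_inf [set (b t)%:E | t in T] \is a fin_num ->
  (forall t, T t -> `|a t - b t| <= c) ->
  (`|ereal_inf [set (a t)%:E | t in T] - ereal_inf [set (b t)%:E | t in T]|
     <= c%:E)%E.
Proof.
move=> /fineK; set r := fine _ => bE ab.
have lower : ((r - c)%:E <= ereal_inf [set (a t)%:E | t in T])%E.
  apply/ereal_infP => _ [t Tt <-]; rewrite lee_fin.
  have : (r%:E <= (b t)%:E)%E by rewrite bE; apply: ereal_inf_lbound; exists t.
  by rewrite lee_fin; have := ab t Tt; rewrite ler_norml; lra.
have upper : (ereal_inf [set (a t)%:E | t in T] - c%:E <= r%:E)%E.
  rewrite bE; apply/ereal_infP => _ [t Tt <-]; rewrite leeBlDr//.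
  apply: (@le_trans _ _ (a t)%:E); first by apply: ereal_inf_lbound; exists t.
  by rewrite -EFinD lee_fin; have := ab t Tt; rewrite ler_norml; lra.
(* The two bounds exclude both infinite values of the remaining infimum. *)
rewrite -bE; case: (ereal_inf _) lower upper => [x| |]//=.
rewrite -!EFinB !lee_fin ler_norml => *; apply/andP; split; lra.
Qed.

Lemma min_coverP d (T : measurableType d) (R : realType) (mu : probability T R)
  (h : T -> \bar R) : is_min_cover mu h (min_cover mu h).
Proof. exact: svalP. Qed.

(** The tolerance one gives finiteness from some index on; convergence can then be checked on real
    numbers. *)
Lemma cvge0_le (R : realType) (h : nat -> \bar R) : (forall n, 0 <= h n)%E ->
  (forall e : R, 0 < e -> \forall n \near \oo, (h n <= e%:E)%E) ->
  h @ \oo --> 0%E.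
Proof.
move=> h0 he; have fin : \forall n \near \oo, h n \is a fin_num.
  apply: filterS (he 1 ltr01) => n hn; rewrite ge0_fin_numE//.
  exact: le_lt_trans hn (ltry _).
apply/fine_cvgP; split => //; apply/cvgrPdist_le => e e0.
apply: filterS2 fin (he e e0) => n fn hn.
rewrite sub0r normrN /= ger0_norm ?fine_ge0//.
by rewrite -lee_fin fineK.
Qed.

(** * Strong consistency under the Lipschitz condition *)

Theorem theorem12 (R : realType) (m : nat) (m_gt0 : (0 < m)%N)
    (T : set 'rV[R]_m) (T_neq0 : T !=set0) (T_bounded : bounded_set T)
    (N : 'rV[R]_m -> R) (N_norm : is_norm N)
    (P : probability R R) (P_ : 'rV[R]_m -> probability R R)
    (Pinf : probability (seqR R) R) (PinfP : is_product_measure P Pinf)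
    (f : R -> R) (mf : measurable_fun setT f)
    (f_sup : (ereal_sup [set 'E_(P_ t)[fun x => `|f x|%R] | t in T] < +oo)%E)
    (f_ : 'rV[R]_m -> R -> R)
    (mf_ : forall t, T t -> measurable_fun setT (f_ t))
    (Ef_ : forall t, T t -> ('E_P[f_ t] = 'E_(P_ t)[f])%E)
    (Eabsf_ : forall t, T t ->
      ('E_P[fun x => `|f_ t x|%R] = 'E_(P_ t)[fun x => `|f x|%R])%E) :
  (exists F : R -> R, [/\ measurable_fun setT F,
      ('E_P[fun x => `|F x|%R] < +oo)%E &
      forall s t x, T s -> T t -> `|f_ s x - f_ t x| <= N (s - t) * F x]) ->
  strongly_consistent Pinf (lower_estimator T f_) (lower_expectation T P_ f).
Proof.
case=> F [mF F1 fF].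
have [t0 Tt0] := T_neq0.
have N0 := is_norm_ge0 N_norm.
have intF : P.-integrable setT (EFin \o (fun x => `|F x|)).
  apply/integrableP; split.
    by apply/measurable_EFinP; exact: measurableT_comp.
  move: F1; rewrite unlock; congr (_ < _)%E; apply: eq_integral => x _ /=.
  by rewrite normr_id.
pose S : \bar R := (ereal_sup [set 'E_(P_ t)[fun x => `|f x|%R] | t in T])%E.
have S0 : (0 <= S)%E.
  apply: (@le_trans _ _ ('E_(P_ t0)[fun x => `|f x|%R]))%E.
    by rewrite unlock; apply: integral_ge0 => x _; rewrite lee_fin.
  by apply: ereal_sup_ubound; exists t0.
have Sfin : S \is a fin_num by rewrite ge0_fin_numE.
have absint t : T t -> (\int[P]_x `|f_ t x|%:E <= S)%E.
  move=> Tt; have := Eabsf_ t Tt; rewrite [in X in X -> _]unlock => ->.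
  by apply: ereal_sup_ubound; exists t => //; rewrite unlock.
have intf t : T t -> P.-integrable setT (EFin \o f_ t).
  move=> Tt; apply/integrableP; split.
    by apply/measurable_EFinP; exact: mf_.
  exact: le_lt_trans (absint t Tt) f_sup.
pose E t := fine (\int[P]_x (f_ t x)%:E)%E.
have EE t : T t -> ((E t)%:E = \int[P]_x (f_ t x)%:E)%E.
  by move=> Tt; rewrite fineK// integrable_fin_num//; exact: intf.
pose EF := fine (\int[P]_x `|F x|%:E)%E.
have EFE : (EF%:E = \int[P]_x `|F x|%:E)%E.
  by rewrite fineK// integrable_fin_num.
have EF0 : 0 <= EF by rewrite fine_ge0// integral_ge0.
have thetaE : lower_expectation T P_ f = ereal_inf [set (E t)%:E | t in T].
  congr ereal_inf; apply/seteqP; split => _ [t Tt <-]; exists t => //.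
    by rewrite -Ef_// EE// unlock.
  by rewrite -Ef_// EE// unlock.
(* Every mean is at least [- S], and the infimum is at most the mean at [t0]. *)
have theta_fin : ereal_inf [set (E t)%:E | t in T] \is a fin_num.
  rewrite fin_numE; apply/andP; split; rewrite -?ltNye -?ltey.
    apply: (@lt_le_trans _ _ (- S)%E); first by rewrite ltNye -[S]fineK.
    apply/ereal_infP => _ [t Tt <-].
    rewrite leeNl; apply: le_trans (absint t Tt).
    apply: (@le_trans _ _ `|\int[P]_x (f_ t x)%:E|)%E; last first.
      by apply: le_abse_integral => //; apply/measurable_EFinP; exact: mf_.
    by rewrite -EE// lee_fin -normrN ler_norm.
  apply: (@le_lt_trans _ _ (E t0)%:E); last exact: ltry.
  by apply: ereal_inf_lbound; exists t0.
(* [F] is not assumed nonnegative, so its absolute value takes over. *)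
have close_f eps s t x : T s -> T t -> N (s - t) <= eps ->
    `|f_ s x - f_ t x| <= eps * `|F x|.
  move=> Ts Tt st; apply: (le_trans (fF s t x Ts Tt)).
  apply: (@le_trans _ _ (N (s - t) * `|F x|)).
    by rewrite ler_wpM2l// ler_norm.
  by rewrite ler_wpM2r.
have close_E eps s t : T s -> T t -> N (s - t) <= eps ->
    `|E s - E t| <= eps * EF.
  move=> Ts Tt st; have e0 : 0 <= eps by exact: le_trans st.
  rewrite -lee_fin EFinM EFE -abse_EFin EFinB !EE//.
  rewrite -integralB_EFin//; [|exact: intf..].
  rewrite -integralZl//.
  apply: (le_trans (le_abse_integral _ _ _)) => //.
    by apply: emeasurable_funB; apply/measurable_EFinP; exact: mf_.
  apply: ge0_le_integral => //.
  - apply: measurableT_comp => //.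
    by apply: emeasurable_funB; apply/measurable_EFinP; exact: mf_.
  - apply: emeasurable_funM => //; apply/measurable_EFinP.
    exact: measurableT_comp.
  - by move=> x _; rewrite -EFinB abse_EFin -EFinM lee_fin; exact: close_f.
pose A n (h : R -> R) (w : seqR R) := n%:R^-1 * \sum_(k < n) h (w k).
have close_A eps s t n w : T s -> T t -> N (s - t) <= eps ->
    `|A n (f_ s) w - A n (f_ t) w| <= eps * A n (fun x => `|F x|) w.
  move=> Ts Tt st; rewrite -mulrBr -sumrB normrM ger0_norm ?invr_ge0//.
  rewrite mulrCA ler_wpM2l ?invr_ge0//.
  apply: (le_trans (ler_norm_sum _ _ _)); rewrite mulr_sumr.
  by apply: ler_sum => k _; exact: close_f.
have inv0 (p : nat) : 0 < p.+1%:R^-1 :> R by rewrite invr_gt0.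
have /choice[s sP] (p : nat) : exists s : seq 'rV[R]_m,
    (forall u, u \in s -> T u) /\
    forall t, T t -> exists2 u, u \in s & N (t - u) <= p.+1%:R^-1.
  by have [s sT sN] := bounded_finite_net N_norm T_bounded (inv0 p); exists s.
(* The majorant over the [p]-th net: as a finite sum it is measurable in [w], whereas an infimum
   over [T] need not be. *)
pose G p n w := \sum_(i < size (s p))
    `|A n (f_ (nth t0 (s p) i)) w - E (nth t0 (s p) i)| +
  p.+1%:R^-1 * A n (fun x => `|F x|) w + p.+1%:R^-1 * EF.
have mA n h : measurable_fun setT h -> measurable_fun setT (A n h).
  move=> mh; apply: measurable_funM => //; apply: measurable_sum => k.
  by apply: measurableT_comp => //; exact: measurable_coord.
pose h n w := `|lower_estimator T f_ n w - lower_expectation T P_ f|%E.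
have hG p n w : (h n w <= (G p n w)%:E)%E.
  rewrite /h thetaE; apply: ereal_inf_dist_le => // t Tt.
  have [Ts /(_ t Tt)[u us tu]] := sP p; have Tu := Ts u us.
  (* The path from the sample mean at [t] to the mean at [t] goes through the sample mean and the
     mean at the nearby net point [u]. *)
  have -> : A n (f_ t) w - E t = (A n (f_ u) w - E u) +
    (A n (f_ t) w - A n (f_ u) w) + (E u - E t) by ring.
  apply: (le_trans (ler_normD _ _)); apply: lerD; last first.
    by rewrite distrC; exact: close_E.
  apply: (le_trans (ler_normD _ _)); apply: lerD; last exact: close_A.
  have iu : (index u (s p) < size (s p))%N by rewrite index_mem.
  by rewrite (bigD1 (Ordinal iu))//= nth_index// lerDl sumr_ge0.
(* Indices beyond the net fall back on [t0], a point of [T], so the strong law can be stated for all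
   [i]. *)
have sT p i : T (nth t0 (s p) i).
  have [ip|ip] := ltnP i (size (s p)); last by rewrite nth_default.
  by have [sT _] := sP p; apply: sT; exact: mem_nth.
(* Each pair [p], [n] has its own null set; there are countably many. *)
have ae_cover : {ae Pinf, forall w, forall p n,
    (min_cover Pinf (h n) w <= (G p n w)%:E)%E}.
  apply: ae_foralln => p; apply: ae_foralln => n.
  have [_ _] := min_coverP Pinf (h n); apply => [|w]; last exact: hG.
  apply/measurable_EFinP; apply: measurable_funD => //; apply: measurable_funD.
    apply: measurable_sum => i; apply: measurableT_comp => //.
    by apply: measurable_funB => //; apply: mA; exact: mf_.
  by apply: measurable_funM => //; apply: mA; exact: measurableT_comp.
have ae_slln : {ae Pinf, forall w, forall p i,
    A n (f_ (nth t0 (s p) i)) w @[n --> \oo] --> E (nth t0 (s p) i)}.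
  apply: ae_foralln => p; apply: ae_foralln => i.
  exact: (strong_law_of_large_numbers PinfP (intf _ (sT p i))).
have ae_slln_F : {ae Pinf, forall w,
    A n (fun x => `|F x|) w @[n --> \oo] --> EF}.
  exact: (strong_law_of_large_numbers PinfP intF).
apply: filterS3 ae_cover ae_slln ae_slln_F => w cover slln sllnF.
apply: cvge0_le => [n|e e0].
  have [_ + _] := min_coverP Pinf (h n) => /(_ w).
  by apply: le_trans; exact: abse_ge0.
(* The limit of [G p] is twice [p.+1%:R^-1 * EF], so half of [e] is allotted to each copy. *)
have [p pe] : exists p : nat, p.+1%:R^-1 * EF < e / 2.
  (* [EF + 1] avoids a division by zero when [EF] vanishes. *)
  have [p pe] : exists p : nat, p.+1%:R^-1 < e / (2 * (EF + 1)).
    have d0 : 0 < e / (2 * (EF + 1)) by rewrite divr_gt0// mulr_gt0// ltr_wpDl.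
    near \oo => p; exists p; near: p; exact: near_infty_natSinv_lt (PosNum d0).
  exists p; apply: (@le_lt_trans _ _ (p.+1%:R^-1 * (EF + 1))).
    by rewrite ler_wpM2l// ?ltW// ltrDl.
  by rewrite -ltr_pdivlMr ?ltr_wpDl// -mulrA -invfM.
have Gcvg : G p n w @[n --> \oo] -->
    \sum_(i < size (s p)) 0 + p.+1%:R^-1 * EF + p.+1%:R^-1 * EF.
  apply: cvgD; last exact: cvg_cst.
  apply: cvgD; last by apply: cvgMr; exact: sllnF.
  apply: cvg_big => [|i _]; first exact: add_continuous.
  rewrite -(@normr0 _ R) -(subrr (E (nth t0 (s p) i))).
  by apply: cvg_norm; apply: cvgB; [exact: slln|exact: cvg_cst].
have Glt : \forall n \near \oo, G p n w < e.
  apply: (cvgr_lt _ Gcvg); by rewrite big1// add0r [e]splitr ltrD.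
apply: filterS Glt => n Gn; apply: (le_trans (cover p n)).
by rewrite lee_fin ltW.
Unshelve. all: by end_near. Qed.
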